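(* Let $X\subset\mathbb{R}^n$ be nonempty and open, let $f_j\colon X\to\mathbb{R}$ ($j\in J:=\{1,\dots,p\}$) and $g_i\colon X\to\mathbb{R}$ ($i\in I:=\{1,\dots,m\}$) be continuously differentiable, and let $\mathcal{F}:=\{x\in X: g_i(x)\le 0,\ i\in I\}$. Consider the vector optimization problem (VP) of minimizing $f=(f_1,\dots,f_p)$ over $\mathcal{F}$ with respect to the componentwise order. Let $\bar x\in\mathcal{F}$. Suppose that $f_j$, $j\in J$, and $g_i$, $i\in I(\bar x)$, are second-order directionally differentiable at $\bar x$ in every critical direction $d\in\mathcal{C}(\bar x)$, that $f_j$, $j\in J$, are strictly $2$-pseudoconvex at $\bar x$, and that $g_i$, $i\in I(\bar x)$, are quasiconvex at $\bar x$. If for each $d\in\mathcal{C}(\bar x)$ there exist $\mu\in\mathbb{R}^p_+\setminus\{0\}$ and $\lambda\in\mathbb{R}^m_+$ such that $$\sum_{j=1}^p\mu_j\nabla f_j(\bar x)+\sum_{i=1}^m\lambda_i\nabla g_i(\bar x)=0,$$ $$\sum_{j=1}^p\mu_j f_j''(\bar x;d)+\sum_{i=1}^m\lambda_i g_i''(\bar x;d)\ge0,$$ $$\lambda_i g_i(\bar x)=0\quad\text{for all } i\in I,$$ then $\bar x$ is a strict global efficient solution of (VP).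
   Context: $\langle\cdot,\cdot\rangle$ is the Euclidean scalar product; $\mathbb{R}^p_+$ is the nonnegative orthant. Second-order directional derivative (Demyanov--Pevnyi): for $\phi\colon X\to\mathbb{R}$ differentiable at $x\in X$ and $d\in\mathbb{R}^n$, $$\phi''(x;d):=\lim_{t\downarrow0}\frac{2}{t^2}\big[\phi(x+td)-\phi(x)-t\langle\nabla\phi(x),d\rangle\big];$$ $\phi$ is second-order directionally differentiable at $x$ in the direction $d$ if this limit exists and is finite. $I(\bar x):=\{i\in I: g_i(\bar x)=0\}$. The set of critical directions at $\bar x$ is $\mathcal{C}(\bar x):=\{d\in\mathbb{R}^n:\langle\nabla f_j(\bar x),d\rangle\le0\ \forall j\in J,\ \langle\nabla g_i(\bar x),d\rangle\le0\ \forall i\in I(\bar x)\}$. Quasiconvexity: $\phi\colon X\to\mathbb{R}$ is quasiconvex at $\bar x$ if $y\in X$, $\phi(y)\le\phi(\bar x)$, $t\in[0,1]$, $(1-t)\bar x+ty\in X$ imply $\phi(\bar x+t(y-\bar x))\le\phi(\bar x)$. Strict $2$-pseudoconvexity: let $\phi\colon X\to\mathbb{R}$ be differentiable at $\bar x$ and second-order directionally differentiable at $\bar x$ in every direction $y-\bar x$ with $y\in X$, $\phi(y)\le\phi(\bar x)$, $\langle\nabla\phi(\bar x),y-\bar x\rangle=0$. Then $\phi$ is strictly $2$-pseudoconvex at $\bar x$ if for all $y\in X$ with $y\ne\bar x$: (i) $\phi(y)\le\phi(\bar x)$ implies $\langle\nabla\phi(\bar x),y-\bar x\rangle\le0$;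 (ii) $\phi(y)\le\phi(\bar x)$ and $\langle\nabla\phi(\bar x),y-\bar x\rangle=0$ imply $\phi''(\bar x;y-\bar x)<0$. Strict global efficient solution: $\bar x\in\mathcal{F}$ such that there is no $x\in\mathcal{F}$ with $x\ne\bar x$ and $f_j(x)\le f_j(\bar x)$ for all $j\in J$. Convention: a term $\lambda_i g_i''(\bar x;d)$ with $\lambda_i=0$ (in particular with $i\notin I(\bar x)$) is taken to be $0$. *)

(* Defs.v *)
From HB Require Import structures.
From mathcomp Require Export all_boot all_order all_algebra.
From mathcomp Require Export all_classical all_reals all_analysis.
Export Order.TTheory GRing.Theory Num.Theory.
Export numFieldNormedType.Exports.

Set Implicit Arguments.
Unset Strict Implicit.
Unset Printing Implicit Defensive.

Local Open Scope classical_set_scope.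
Local Open Scope ring_scope.

(* A function X -> R with X open is represented by a total function on
   'rV[R]_n.  Every notion below depends only on its values on X: derivatives
   and limits at a point of X only involve a neighbourhood of that point. *)

Definition inner (R : realType) (n : nat) (u v : 'rV[R]_n) : R :=
  \sum_(k < n) u 0 k * v 0 k.

Definition nonneg_orthant (R : realType) (n : nat) : set 'rV[R]_n :=
  [set v | forall k, 0 <= v 0 k].

Definition grad (R : realType) (n : nat) (phi : 'rV[R]_n -> R)
    (x : 'rV[R]_n) : 'rV[R]_n :=
  \row_(k < n) 'D_(delta_mx 0 k) phi x.

Definition continuously_differentiable (R : realType) (n : nat)
    (X : set 'rV[R]_n) (phi : 'rV[R]_n -> R) : Prop :=
  (forall x, X x -> differentiable phi x) /\ {within X, continuous (grad phi)}.

Definition second_order_quotient (R : realType) (n : nat)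
    (phi : 'rV[R]_n -> R) (x d : 'rV[R]_n) (t : R) : R :=
  2 / t ^+ 2 * (phi (x + t *: d) - phi x - t * inner (grad phi x) d).

(* [cvg] in R means convergence to a finite limit. *)
Definition second_order_dir_differentiable (R : realType) (n : nat)
    (phi : 'rV[R]_n -> R) (x d : 'rV[R]_n) : Prop :=
  cvg (second_order_quotient phi x d t @[t --> 0^'+]).

(* [lim] is total, so a multiple [0 * second_order_dir_deriv phi x d] is 0
   even when the limit does not exist. *)
Definition second_order_dir_deriv (R : realType) (n : nat)
    (phi : 'rV[R]_n -> R) (x d : 'rV[R]_n) : R :=
  lim (second_order_quotient phi x d t @[t --> 0^'+]).

Definition quasiconvex_at (R : realType) (n : nat) (X : set 'rV[R]_n)
    (phi : 'rV[R]_n -> R) (xbar : 'rV[R]_n) : Prop :=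
  forall (y : 'rV[R]_n) (t : R),
    X y -> phi y <= phi xbar -> 0 <= t <= 1 ->
    X ((1 - t) *: xbar + t *: y) ->
    phi (xbar + t *: (y - xbar)) <= phi xbar.

Definition strictly_2_pseudoconvex_at (R : realType) (n : nat)
    (X : set 'rV[R]_n) (phi : 'rV[R]_n -> R) (xbar : 'rV[R]_n) : Prop :=
  [/\ differentiable phi xbar,
      (forall y, X y -> phi y <= phi xbar ->
         inner (grad phi xbar) (y - xbar) = 0 ->
         second_order_dir_differentiable phi xbar (y - xbar)),
      (forall y, X y -> y != xbar -> phi y <= phi xbar ->
         inner (grad phi xbar) (y - xbar) <= 0) &
      (forall y, X y -> y != xbar -> phi y <= phi xbar ->
         inner (grad phi xbar) (y - xbar) = 0 ->
         second_order_dir_deriv phi xbar (y - xbar) < 0)].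

Definition feasible (R : realType) (n m : nat) (X : set 'rV[R]_n)
    (g : 'I_m -> 'rV[R]_n -> R) : set 'rV[R]_n :=
  [set x | X x /\ forall i, g i x <= 0].

Definition active (R : realType) (n m : nat) (g : 'I_m -> 'rV[R]_n -> R)
    (x : 'rV[R]_n) : set 'I_m :=
  [set i | g i x = 0].

Definition critical_directions (R : realType) (n p m : nat)
    (f : 'I_p -> 'rV[R]_n -> R) (g : 'I_m -> 'rV[R]_n -> R)
    (x : 'rV[R]_n) : set 'rV[R]_n :=
  [set d | (forall j, inner (grad (f j) x) d <= 0) /\
           (forall i, active g x i -> inner (grad (g i) x) d <= 0)].

Definition strict_global_efficient (R : realType) (n p : nat)
    (F : set 'rV[R]_n) (f : 'I_p -> 'rV[R]_n -> R) (xbar : 'rV[R]_n) : Prop :=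
  F xbar /\
  ~ exists x, [/\ F x, x != xbar & forall j, f j x <= f j xbar].

(* Main.v *)
(* If x <> xbar were feasible with f x <= f xbar, then d = x - xbar would be a
   critical direction.  Pairing the multiplier rule for d with d gives a
   vanishing sum of nonpositive terms, so every f_j and g_i with a positive
   multiplier has zero slope along d.  For these f_j strict
   2-pseudoconvexity gives f_j''(xbar; d) < 0; for these g_i quasiconvexity makes
   the second-order quotients nonpositive.  As mu <> 0, the second-order
   sum is negative, a contradiction. *)

Require Import Defs.

Local Open Scope classical_set_scope.
Local Open Scope ring_scope.

(** The differential is linear, so its value at [d] is recovered from its values on the canonical
    basis, the entries of [grad phi x]. *)
Lemma inner_gradE (R : realType) (n : nat) (phi : 'rV[R]_n -> R)
    (x d : 'rV[R]_n) :
  differentiable phi x -> inner (grad phi x) d = 'D_d phi x.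
Proof.
move=> dphi; rewrite deriveE// {2}(row_sum_delta d) linear_sum.
by apply: eq_bigr => k _; rewrite mxE deriveE// linearZ/= mulrC.
Qed.

Lemma inner_sumZl (R : realType) (n p : nat) (c : 'I_p -> R)
    (u : 'I_p -> 'rV[R]_n) (d : 'rV[R]_n) :
  inner (\sum_j c j *: u j) d = \sum_j c j * inner (u j) d.
Proof.
rewrite /inner; under eq_bigr => k _ do rewrite summxE mulr_suml.
rewrite exchange_big; apply: eq_bigr => j _; rewrite mulr_sumr.
by apply: eq_bigr => k _; rewrite mxE mulrA.
Qed.

Lemma innerDl (R : realType) (n : nat) (u v d : 'rV[R]_n) :
  inner (u + v) d = inner u d + inner v d.
Proof. by rewrite -big_split; apply: eq_bigr => k _; rewrite mxE mulrDl. Qed.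

Lemma inner0l (R : realType) (n : nat) (d : 'rV[R]_n) : inner 0 d = 0.
Proof. by rewrite /inner big1// => k _; rewrite mxE mul0r. Qed.

(** Removing the [i]-th term leaves a nonpositive sum, hence [F i] is at least the whole sum. *)
Lemma sum_le0_eq0 (R : realType) (I : finType) (F : I -> R) :
  (forall i, F i <= 0) -> 0 <= \sum_i F i -> forall i, F i = 0.
Proof.
move=> F_le0 sum_ge0 i; apply/eqP; rewrite eq_le F_le0/=.
by apply: (le_trans sum_ge0); rewrite (bigD1 i)//= gerDl sumr_le0.
Qed.

(** The difference quotients along [d] are nonpositive for small [t > 0], and the derivative is also
    their one-sided limit. *)
Lemma inner_grad_le0 (R : realType) (n : nat) (phi : 'rV[R]_n -> R)
    (x d : 'rV[R]_n) :
  differentiable phi x -> (\forall t \near 0^'+, phi (x + t *: d) <= phi x) ->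
  inner (grad phi x) d <= 0.
Proof.
move=> dphi phi_le; rewrite inner_gradE//.
have := cvg_dnbhs_at_right (diff_derivable (v := d) dphi).
move=> /cvgr_to_le; apply; near=> t => /=.
have t_gt0 : 0 < t by near: t; exact: nbhs_right_gt.
rewrite pmulr_rle0 ?invr_gt0// subr_le0 addrC.
by near: t.
Unshelve. all: by end_near. Qed.

(** With zero slope the first-order term drops out, so the sign of the quotient is that of
    [phi (x + t *: d) - phi x]. *)
Lemma second_order_dir_deriv_le0 (R : realType) (n : nat)
    (phi : 'rV[R]_n -> R) (x d : 'rV[R]_n) :
  second_order_dir_differentiable phi x d -> inner (grad phi x) d = 0 ->
  (\forall t \near 0^'+, phi (x + t *: d) <= phi x) ->
  second_order_dir_deriv phi x d <= 0.
Proof.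
move=> sdphi grad0 phi_le; apply: limr_le => //; near=> t.
have t_gt0 : 0 < t by near: t; exact: nbhs_right_gt.
rewrite /second_order_quotient grad0 mulr0 subr0.
rewrite pmulr_rle0 ?divr_gt0 ?exprn_gt0// subr_le0.
by near: t.
Unshelve. all: by end_near. Qed.

(** [X] need not be convex, so the segment from [x] to [y] may leave it; openness keeps the points
    with small [t] in [X]. *)
Lemma quasiconvex_at_near (R : realType) (n : nat) (X : set 'rV[R]_n)
    (phi : 'rV[R]_n -> R) (x y : 'rV[R]_n) :
  open X -> X x -> quasiconvex_at X phi x -> X y -> phi y <= phi x ->
  \forall t \near 0^'+, phi (x + t *: (y - x)) <= phi x.
Proof.
move=> oX Xx qphi Xy phi_le.
have line_cvg : x + t *: (y - x) @[t --> (0 : R)^'+] --> x.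
  rewrite -[X in _ --> X]addr0 -(scale0r (y - x)).
  apply: cvg_at_right_filter; apply: cvgD; first exact: cvg_cst.
  by apply: cvgZr_tmp; exact: cvg_id.
have nearX : \forall t \near (0 : R)^'+, X (x + t *: (y - x)).
  by apply: line_cvg; exact: open_nbhs_nbhs.
near=> t; apply: qphi => //.
  apply/andP; split; first by apply/ltW; near: t; exact: nbhs_right_gt.
  by near: t; exact: nbhs_right_le.
have -> : (1 - t) *: x + t *: y = x + t *: (y - x).
  by rewrite scalerBl scale1r scalerBr -addrA [- _ + _]addrC.
by near: t.
Unshelve. all: by end_near. Qed.

Theorem theorem3p2 (R : realType) (n p m : nat) (X : set 'rV[R]_n)
    (f : 'I_p -> 'rV[R]_n -> R) (g : 'I_m -> 'rV[R]_n -> R)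
    (xbar : 'rV[R]_n) :
  X !=set0 -> open X ->
  (forall j, continuously_differentiable X (f j)) ->
  (forall i, continuously_differentiable X (g i)) ->
  feasible X g xbar ->
  (forall d, critical_directions f g xbar d ->
     (forall j, second_order_dir_differentiable (f j) xbar d) /\
     (forall i, active g xbar i ->
        second_order_dir_differentiable (g i) xbar d)) ->
  (forall j, strictly_2_pseudoconvex_at X (f j) xbar) ->
  (forall i, active g xbar i -> quasiconvex_at X (g i) xbar) ->
  (forall d, critical_directions f g xbar d ->
     exists (mu : 'rV[R]_p) (lambda : 'rV[R]_m),
       [/\ nonneg_orthant mu /\ mu != 0,
           nonneg_orthant lambda,
           \sum_(j < p) mu 0 j *: grad (f j) xbar
             + \sum_(i < m) lambda 0 i *: grad (g i) xbar = 0,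
           0 <= \sum_(j < p) mu 0 j * second_order_dir_deriv (f j) xbar d
                + \sum_(i < m) lambda 0 i *
                    second_order_dir_deriv (g i) xbar d &
           forall i, lambda 0 i * g i xbar = 0]) ->
  strict_global_efficient (feasible X g) f xbar.
Proof.
move=> _ oX cdf cdg [Xxbar gxbar] sod pcf qcg mult; split=> //.
move=> [x [[Xx gx] x_neq fx]]; set d := x - xbar.
have near_g i : active g xbar i ->
    \forall t \near 0^'+, g i (xbar + t *: d) <= g i xbar.
  move=> act; apply: (quasiconvex_at_near _ _ _ _ _ _ oX Xxbar (qcg i act) Xx).
  (* Activity makes [g i xbar] zero, so feasibility of [x] reads [g i x <= g i xbar]. *)
  by rewrite [g i xbar]act.
have grad_f j : inner (grad (f j) xbar) d <= 0.
  by have [_ _ + _] := pcf j; apply.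
have grad_g i : active g xbar i -> inner (grad (g i) xbar) d <= 0.
  move=> act; apply: inner_grad_le0; last exact: near_g.
  by have [+ _] := cdg i; apply.
have critd : critical_directions f g xbar d by split.
have [_ sod_g] := sod d critd.
have [mu [lambda [[mu_ge0 mu_neq0] lambda_ge0 kkt so_ge0 compl]]] := mult d critd.
have lambda_act i : lambda 0 i = 0 \/ active g xbar i.
  by have /eqP := compl i; rewrite mulf_eq0 => /orP[]/eqP; [left|right].
have mu_le0 j : mu 0 j * inner (grad (f j) xbar) d <= 0.
  by rewrite mulr_ge0_le0// mu_ge0.
have lambda_le0 i : lambda 0 i * inner (grad (g i) xbar) d <= 0.
  have [->|act] := lambda_act i; first by rewrite mul0r.
  by rewrite mulr_ge0_le0 ?grad_g// lambda_ge0.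
have sum0 : \sum_j mu 0 j * inner (grad (f j) xbar) d +
    \sum_i lambda 0 i * inner (grad (g i) xbar) d = 0.
  by rewrite -!inner_sumZl -innerDl kkt inner0l.
have mu_eq0 : forall j, mu 0 j * inner (grad (f j) xbar) d = 0.
  apply: sum_le0_eq0 => //.
  (* Replacing 0 by the total of both sums reduces the bound to the other sum being nonpositive. *)
  by rewrite -[X in X <= _]sum0 gerDl sumr_le0.
have lambda_eq0 : forall i, lambda 0 i * inner (grad (g i) xbar) d = 0.
  apply: sum_le0_eq0 => //.
  by rewrite -[X in X <= _]sum0 gerDr sumr_le0.
have f_lt0 j : mu 0 j != 0 -> second_order_dir_deriv (f j) xbar d < 0.
  move=> /negPf mu_neq; have /eqP := mu_eq0 j.
  rewrite mulf_eq0 mu_neq/= => /eqP grad0.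
  by have [_ _ _ +] := pcf j; apply.
have so_f j : mu 0 j * second_order_dir_deriv (f j) xbar d <= 0.
  have [->|/f_lt0/ltW ?] := eqVneq (mu 0 j) 0; first by rewrite mul0r.
  by rewrite mulr_ge0_le0// mu_ge0.
have so_g i : lambda 0 i * second_order_dir_deriv (g i) xbar d <= 0.
  (* For inactive [i] the second-order limit may fail to exist, but then complementarity gives
     [lambda 0 i = 0] and the product is 0 whatever the value of [lim]. *)
  have [->|neq0] := eqVneq (lambda 0 i) 0; first by rewrite mul0r.
  have [eq0|act] := lambda_act i; first by rewrite eq0 eqxx in neq0.
  apply: mulr_ge0_le0; first exact: lambda_ge0.
  apply: second_order_dir_deriv_le0; [exact: sod_g| |exact: near_g].
  by apply/(mulfI neq0); rewrite lambda_eq0 mulr0.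
have /rV0Pn[j mu_j] := mu_neq0.
(* Dropping the nonpositive [g] part leaves a nonnegative sum of nonpositive terms, so each term
   vanishes, including the one at [j], whose two factors are nonzero. *)
have : 0 <= \sum_j mu 0 j * second_order_dir_deriv (f j) xbar d.
  by apply: (le_trans so_ge0); rewrite gerDl sumr_le0.
move=> /(sum_le0_eq0 _ _ _ so_f)/(_ j)/eqP.
by rewrite mulf_eq0 (negPf mu_j) (lt_eqF (f_lt0 j mu_j)).
Qed.
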